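(* Let $G$ be a group, let $k$ be a commutative field, and let $\mathcal{L}$ be a local system of subgroups of $G$. If $X$ and $Y$ are $G$-modules (over $k$), then the localization map $$\operatorname{Ext}^i_G(X, Y^\vee) \longrightarrow \operatorname{Ext}^i_{\mathcal{L}}(X, Y^\vee)$$ is an isomorphism for every cohomological degree $i \ge 0$.
   Context: A local system $\mathcal{L}$ of $G$ is an upwardly directed (under inclusion) collection of subgroups of $G$ whose union is $G$. Modules are $k$-spaces: a $G$-module is a $k$-vector space (of arbitrary dimension) on which $G$ acts $k$-linearly. For a module $V$, $V^\vee = \operatorname{Hom}_k(V,k)$ denotes its dual with the contragredient $G$-action. For a subgroup $L\le G$ (including $L = G$) and $G$-modules $X$, $Z$, $\operatorname{Ext}^i_L(X,Z)$ denotes the group cohomology $\mathrm{H}^i(L,\operatorname{Hom}_k(X,Z))$, where $L$ acts on $\operatorname{Hom}_k(X,Z)$ by the usual diagonal (conjugation) action. The local cohomology is the inverse limit $\operatorname{Ext}^i_{\mathcal{L}}(X,Z) := \varprojlim_{L\in\mathcal{L}} \operatorname{Ext}^i_L(X,Z)$ taken with respect to the restriction maps $\operatorname{Ext}^i_L(X,Z) \to \operatorname{Ext}^i_{L'}(X,Z)$ for $L \supset L'$ in $\mathcal{L}$. The localization map $\operatorname{Ext}^i_G(X,Z)\to\operatorname{Ext}^i_{\mathcal{L}}(X,Z)$ sends a class to the family of its restrictions to the subgroups $L\in\mathcal{L}$. *)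

(* Defs.v *)
From HB Require Import structures.
From mathcomp Require Import all_boot all_order all_algebra.
From mathcomp Require Import boolp classical_sets functions.

Set Implicit Arguments.
Unset Strict Implicit.
Unset Printing Implicit Defensive.

Import GRing.Theory.
Local Open Scope ring_scope.
Local Open Scope quotient_scope.

Section LinearMaps.
Variables (k : comPzRingType) (U V : lmodType k).
Implicit Types (f g h : {linear U -> V}) (a b : k).

HB.instance Definition _ := gen_eqMixin {linear U -> V}.
HB.instance Definition _ := gen_choiceMixin {linear U -> V}.

Lemma linear_map_ext f g : f =1 g -> f = g.
Proof.
case: f g => [f [fA fS]] [g [gA gS]] /= /funext fg.
rewrite -{g}fg in gA gS *.
by case: fA fS gA gS => fA [fS] [gA] [gS];
  rewrite (Prop_irrelevance fA gA) (Prop_irrelevance fS gS).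
Qed.

Definition lin_zero : {linear U -> V} := \0.
Definition lin_opp f : {linear U -> V} := \- f.
Definition lin_add f g : {linear U -> V} := f \+ g.
Definition lin_scale a f : {linear U -> V} := a \*: f.

Let addA : associative lin_add.
Proof. by move=> f g h; apply: linear_map_ext => x /=; rewrite addrA. Qed.
Let addC : commutative lin_add.
Proof. by move=> f g; apply: linear_map_ext => x /=; rewrite addrC. Qed.
Let add0 : left_id lin_zero lin_add.
Proof. by move=> f; apply: linear_map_ext => x /=; rewrite add0r. Qed.
Let addN : left_inverse lin_zero lin_opp lin_add.
Proof. by move=> f; apply: linear_map_ext => x /=; rewrite addNr. Qed.

HB.instance Definition _ :=
  GRing.isZmodule.Build {linear U -> V} addA addC add0 addN.

Let scaleA a b f : lin_scale a (lin_scale b f) = lin_scale (a * b) f.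
Proof. by apply: linear_map_ext => x /=; rewrite scalerA. Qed.
Let scale1 : left_id 1 lin_scale.
Proof. by move=> f; apply: linear_map_ext => x /=; rewrite scale1r. Qed.
Let scaleDr : right_distributive lin_scale +%R.
Proof. by move=> a f g; apply: linear_map_ext => x /=; rewrite scalerDr. Qed.
Let scaleDl f : {morph lin_scale^~ f : a b / a + b}.
Proof. by move=> a b; apply: linear_map_ext => x /=; rewrite scalerDl. Qed.

HB.instance Definition _ :=
  GRing.Zmodule_isLmodule.Build k {linear U -> V} scaleA scale1 scaleDr scaleDl.

End LinearMaps.

Record gmodule (k : fieldType) (G : groupType) := GModule {
  gmod_space :> lmodType k;
  act : G -> {linear gmod_space -> gmod_space};
  act1 : forall v, act 1%g v = v;
  actM : forall g h v, act (g * h)%g v = act g (act h v)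
}.

Section Modules.
Variables (k : fieldType) (G : groupType).

Section Hom.
Variables X Z : gmodule k G.

Definition hom_act_fun (g : G) (f : {linear X -> Z}) : {linear X -> Z} :=
  act Z g \o (f \o act X g^-1%g).

Fact hom_act_linear g : linear (hom_act_fun g).
Proof. by move=> a f1 f2; apply: linear_map_ext => x /=; rewrite linearP. Qed.

HB.instance Definition _ g := GRing.isLinear.Build k {linear X -> Z}
  {linear X -> Z} *:%R (hom_act_fun g) (hom_act_linear g).

Fact hom_act1 f : hom_act_fun 1%g f = f.
Proof. by apply: linear_map_ext => x /=; rewrite invg1 !act1. Qed.

Fact hom_actM g h f : hom_act_fun (g * h)%g f = hom_act_fun g (hom_act_fun h f).
Proof. by apply: linear_map_ext => x /=; rewrite invgM !actM. Qed.

(* (g f)(x) = g (f (g^-1 x)) *)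
Definition hom_gmodule : gmodule k G :=
  @GModule k G {linear X -> Z} (fun g => hom_act_fun g) hom_act1 hom_actM.

End Hom.

(* k with the trivial action *)
Definition trivial_gmodule : gmodule k G :=
  @GModule k G k^o (fun=> idfun) (fun=> erefl) (fun _ _ _ => erefl).

(* The contragredient action; see dual_actE. *)
Definition dual (V : gmodule k G) : gmodule k G := hom_gmodule V trivial_gmodule.

Lemma dual_actE (V : gmodule k G) (g : G) (f : dual V) (v : V) :
  (act (dual V) g f : {linear V -> k^o}) v
  = (f : {linear V -> k^o}) (act V g^-1%g v).
Proof. by []. Qed.

End Modules.

Section Subgroups.
Variable G : groupType.

Definition elements (L : groupClosed G) := {x : G | x \in L}.

HB.instance Definition _ L := SubChoice.on (elements L).

Fact elements_group_closed (L : groupClosed G) : group_closed L.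
Proof. by split; [exact: gpred1 | exact: gpredF]. Qed.

HB.instance Definition _ L := SubChoice_isSubGroup.Build G _ (elements L)
  (elements_group_closed L).

Definition include (L L' : groupClosed G) (sLL' : {subset L' <= L})
  (x : elements L') : elements L := Sub (val x) (sLL' _ (valP x)).

Definition whole_pred : {pred G} := predT.

HB.instance Definition _ := isMulClosed.Build G whole_pred (fun _ _ _ _ => isT).
HB.instance Definition _ := isInvClosed.Build G whole_pred (fun _ _ => isT).
HB.instance Definition _ := isMul1Closed.Build G whole_pred isT.

Definition whole : groupClosed G := whole_pred.

Lemma sub_whole (L : groupClosed G) : {subset L <= whole}.
Proof. by []. Qed.

(* The system is nonempty: by the second condition, some member contains 1. *)
Definition local_system (LL : set (groupClosed G)) :=
  (forall L1 L2, LL L1 -> LL L2 ->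
     exists L3, [/\ LL L3, {subset L1 <= L3} & {subset L2 <= L3}])
  /\ (forall g : G, exists2 L, LL L & g \in L).

End Subgroups.

Arguments whole : clear implicits.
Arguments whole_pred : clear implicits.
Arguments sub_whole {G} L x.

Section Cohomology.
Variables (k : fieldType) (G : groupType) (M : gmodule k G).

(* Inhomogeneous cochains of the subgroup L with values in the restriction of M
   to L; the cohomology of G itself is the case L = whole G. *)
Definition cochain (L : groupClosed G) (n : nat) := ('I_n -> elements L) -> M.

HB.instance Definition _ L n := GRing.Lmodule.on (cochain L n).

(* (g_0, .., g_n) |-> (g_0, .., g_i * g_(i+1), .., g_n) *)
Definition contract (H : groupType) n (i : 'I_n) (g : 'I_n.+1 -> H) : 'I_n -> H :=
  fun j => if (j < i)%N then g (widen_ord (leqnSn n) j)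
           else if j == i then (g (widen_ord (leqnSn n) j) * g (lift ord0 j))%g
           else g (lift ord0 j).

Section Differential.
Variable L : groupClosed G.

(* (d f)(g_0, .., g_n) = g_0 f(g_1, .., g_n)
     + \sum_(i < n) (-1)^(i+1) f(.., g_i * g_(i+1), ..)
     + (-1)^(n+1) f(g_0, .., g_(n-1)) *)
Definition diff_fun n (f : cochain L n) : cochain L n.+1 := fun g =>
  act M (val (g ord0)) (f (g \o lift ord0))
  + \sum_(i < n) (-1) ^+ i.+1 *: f (contract i g)
  + (-1) ^+ n.+1 *: f (g \o widen_ord (leqnSn n)).

Fact diff_linear n : linear (@diff_fun n).
Proof.
move=> a f1 f2; apply/funext => g; rewrite /diff_fun.
have eq_comb x y z x' y' z' : a *: (x + y + z) + (x' + y' + z') =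
    (a *: x + x') + (a *: y + y') + (a *: z + z') :> M.
  by rewrite !scalerDr [LHS]addrACA [in LHS](addrACA (a *: x)).
rewrite -[RHS]/(a *: (_ + _ + _) + (_ + _ + _)) eq_comb; congr (_ + _ + _).
- by rewrite -linearP.
- rewrite scaler_sumr -big_split; apply: eq_bigr => i _ /=.
  by rewrite scalerDr !scalerA [a * _]mulrC.
by rewrite scalerDr !scalerA [a * _]mulrC.
Qed.

HB.instance Definition _ n := GRing.isLinear.Build k (cochain L n)
  (cochain L n.+1) *:%R (@diff_fun n) (@diff_linear n).

Definition diff n : {linear cochain L n -> cochain L n.+1} := @diff_fun n.

Definition cocycle_pred n : {pred cochain L n} := [pred f | `[< diff n f = 0 >]].

Lemma cocycleP n (f : cochain L n) : reflect (diff n f = 0) (f \in @cocycle_pred n).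
Proof. exact: asboolP. Qed.

Fact cocycle_closed n : subsemimod_closed (@cocycle_pred n).
Proof.
split=> [|a f /cocycleP df]; last first.
  by apply/cocycleP; rewrite linearZ /= df scaler0.
split=> [|f g /cocycleP df /cocycleP dg]; first by apply/cocycleP; rewrite linear0.
by apply/cocycleP; rewrite linearD /= df dg addr0.
Qed.

HB.instance Definition _ n :=
  GRing.isSubmodClosed.Build k (cochain L n) (@cocycle_pred n) (@cocycle_closed n).

Definition cocycle n := {f : cochain L n | f \in @cocycle_pred n}.

HB.instance Definition _ n := SubChoice.on (cocycle n).
HB.instance Definition _ n := GRing.SubChoice_isSubLmodule.Build k _ _
  (cocycle n) (@cocycle_closed n).

Definition is_coboundary n : cochain L n -> Prop :=
  match n with
  | 0 => fun f => f = 0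
  | m.+1 => fun f => exists b : cochain L m, f = diff m b
  end.

(* The subspace B^n of Z^n. It is carved out of Z^n, so forming the quotient
   does not rely on d o d = 0. *)
Definition coboundary_pred n : {pred cocycle n} :=
  [pred z | `[< is_coboundary (val z) >]].

Lemma coboundaryP n (z : cocycle n) :
  reflect (is_coboundary (val z)) (z \in @coboundary_pred n).
Proof. exact: asboolP. Qed.

Fact coboundary_closed n : subsemimod_closed (@coboundary_pred n).
Proof.
split=> [|a z /coboundaryP bz]; last first.
  apply/coboundaryP; rewrite linearZ /=.
  case: n z bz => [|n] z /= => [->|[b ->]]; first by rewrite scaler0.
  by exists (a *: b); rewrite linearZ.
split=> [|y z /coboundaryP y_b /coboundaryP z_b].
  apply/coboundaryP; rewrite linear0; case: n => [//|n] /=.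
  by exists 0; rewrite linear0.
apply/coboundaryP; rewrite linearD /=.
case: n y z y_b z_b => [|n] y z /= => [-> ->|[b ->] [c ->]]; first by rewrite addr0.
by exists (b + c); rewrite linearD.
Qed.

HB.instance Definition _ n := GRing.isSubmodClosed.Build k (cocycle n)
  (@coboundary_pred n) (@coboundary_closed n).

Definition cohomology n := Quotient.quot (@coboundary_pred n).

HB.instance Definition _ n := GRing.Zmodule.on (cohomology n).
HB.instance Definition _ n := EqQuotient.on (cohomology n).

Definition coho_class n (z : cocycle n) : cohomology n := \pi_(cohomology n) z.

Lemma coho_class_eq n (y z : cocycle n) :
  coho_class y = coho_class z <-> is_coboundary (val (y - z)).
Proof.
split=> [/eqP|yz].
  by rewrite -Quotient.idealrBE => /coboundaryP.
by apply/eqP; rewrite -Quotient.idealrBE; apply/coboundaryP.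
Qed.

Lemma coho_classP n (c : cohomology n) : exists z, c = coho_class z.
Proof. by exists (repr c); rewrite /coho_class reprK. Qed.

Lemma coho_classD n : {morph @coho_class n : y z / y + z}.
Proof. exact: Quotient.pi_add. Qed.

Definition coho_scale n (a : k) (c : cohomology n) : cohomology n :=
  coho_class (a *: repr c).

Lemma coho_scaleE n a (z : cocycle n) :
  coho_scale a (coho_class z) = coho_class (a *: z).
Proof.
apply/eqP; rewrite -Quotient.idealrBE -scalerBr rpredZ //.
by rewrite Quotient.idealrBE reprK.
Qed.

Let scaleA n a b (c : cohomology n) :
  coho_scale a (coho_scale b c) = coho_scale (a * b) c.
Proof. by have [z ->] := coho_classP c; rewrite !coho_scaleE scalerA. Qed.
Let scale1 n : left_id 1 (@coho_scale n).
Proof. by move=> c; have [z ->] := coho_classP c; rewrite coho_scaleE scale1r. Qed.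
Let scaleDr n : right_distributive (@coho_scale n) +%R.
Proof.
move=> a c d; have [[y ->] [z ->]] := (coho_classP c, coho_classP d).
by rewrite -coho_classD !coho_scaleE scalerDr coho_classD.
Qed.
Let scaleDl n c : {morph (@coho_scale n)^~ c : a b / a + b}.
Proof.
move=> a b; have [z ->] := coho_classP c.
by rewrite !coho_scaleE scalerDl coho_classD.
Qed.

HB.instance Definition _ n := GRing.Zmodule_isLmodule.Build k (cohomology n)
  (@scaleA n) (@scale1 n) (@scaleDr n) (@scaleDl n).

Lemma coho_class_linear n : linear (@coho_class n).
Proof. by move=> a y z; rewrite coho_classD -coho_scaleE. Qed.

End Differential.

Arguments diff {L} n.

Section Restriction.
Variables (L L' : groupClosed G) (sL'L : {subset L' <= L}).

Definition res_cochain n (f : cochain L n) : cochain L' n :=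
  fun g => f (include sL'L \o g).

Lemma res_diff n (f : cochain L n) :
  diff n (res_cochain f) = res_cochain (diff n f).
Proof.
apply/funext => g; rewrite /= /diff_fun /res_cochain; congr (_ + _ + _).
apply: eq_bigr => i _; congr (_ *: f _); apply/funext => j /=; rewrite /contract /=.
by case: ifP => // _; case: ifP => // _; apply/val_inj.
Qed.

Lemma res_coboundary n (f : cochain L n) :
  is_coboundary f -> is_coboundary (res_cochain f).
Proof.
case: n f => [|n] f /= => [->|[b ->]]; first by [].
by exists (res_cochain b); rewrite res_diff.
Qed.

Fact res_cocycle_subproof n (z : cocycle L n) :
  res_cochain (val z) \in @cocycle_pred L' n.
Proof.
by apply/cocycleP; rewrite res_diff; have /cocycleP -> := valP z.
Qed.

Definition res_cocycle n (z : cocycle L n) : cocycle L' n :=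
  Sub (res_cochain (val z)) (res_cocycle_subproof z).

Fact res_cocycle_linear n : linear (@res_cocycle n).
Proof. by move=> a y z; apply/val_inj. Qed.

HB.instance Definition _ n := GRing.isLinear.Build k (cocycle L n)
  (cocycle L' n) *:%R (@res_cocycle n) (@res_cocycle_linear n).

Definition res_fun n (c : cohomology L n) : cohomology L' n :=
  coho_class (res_cocycle (repr c)).

Lemma res_fun_class n (z : cocycle L n) :
  res_fun (coho_class z) = coho_class (res_cocycle z).
Proof.
have /coho_class_eq /res_coboundary : coho_class (repr (coho_class z)) = coho_class z.
  exact: reprK.
by move=> ?; apply/coho_class_eq; rewrite -linearB.
Qed.

Fact res_fun_linear n : linear (@res_fun n).
Proof.
move=> a c d; have [[y ->] [z ->]] := (coho_classP c, coho_classP d).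
by rewrite -coho_class_linear !res_fun_class linearP coho_class_linear.
Qed.

HB.instance Definition _ n := GRing.isLinear.Build k (cohomology L n)
  (cohomology L' n) *:%R (@res_fun n) (@res_fun_linear n).

Definition res n : {linear cohomology L n -> cohomology L' n} := @res_fun n.

End Restriction.

Lemma res_class (L L' : groupClosed G) (s : {subset L' <= L}) n (z : cocycle L n) :
  res s n (coho_class z) = coho_class (res_cocycle s z).
Proof. exact: res_fun_class. Qed.

Lemma res_comp (L1 L2 L3 : groupClosed G) (s21 : {subset L2 <= L1}) (s32 : {subset L3 <= L2})
    (s31 : {subset L3 <= L1}) n (c : cohomology L1 n) :
  res s32 n (res s21 n c) = res s31 n c.
Proof.
have [z ->] := coho_classP c; rewrite !res_class; congr coho_class.
apply/val_inj/funext => g; congr (val z _); apply/funext => i; exact/val_inj.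
Qed.

Variable LL : set (groupClosed G).

Section Limit.
Variable n : nat.

Definition family := forall L : LL, cohomology (val L) n.

HB.instance Definition _ := Choice.on family.

Let fam_add (s t : family) : family := fun L => s L + t L.
Let fam_zero : family := fun=> 0.
Let fam_opp (s : family) : family := fun L => - s L.
Let fam_scale (a : k) (s : family) : family := fun L => a *: s L.

Let fam_addA : associative fam_add.
Proof. by move=> s t u; apply: functional_extensionality_dep => L; exact: addrA. Qed.
Let fam_addC : commutative fam_add.
Proof. by move=> s t; apply: functional_extensionality_dep => L; exact: addrC. Qed.
Let fam_add0 : left_id fam_zero fam_add.
Proof. by move=> s; apply: functional_extensionality_dep => L; exact: add0r. Qed.
Let fam_addN : left_inverse fam_zero fam_opp fam_add.
Proof. by move=> s; apply: functional_extensionality_dep => L; exact: addNr. Qed.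

HB.instance Definition _ :=
  GRing.isZmodule.Build family fam_addA fam_addC fam_add0 fam_addN.

Let fam_scaleA a b s : fam_scale a (fam_scale b s) = fam_scale (a * b) s.
Proof. by apply: functional_extensionality_dep => L; exact: scalerA. Qed.
Let fam_scale1 : left_id 1 fam_scale.
Proof. by move=> s; apply: functional_extensionality_dep => L; exact: scale1r. Qed.
Let fam_scaleDr : right_distributive fam_scale +%R.
Proof. by move=> a s t; apply: functional_extensionality_dep => L; exact: scalerDr. Qed.
Let fam_scaleDl s : {morph fam_scale^~ s : a b / a + b}.
Proof. by move=> a b; apply: functional_extensionality_dep => L; exact: scalerDl. Qed.

HB.instance Definition _ := GRing.Zmodule_isLmodule.Build k family
  fam_scaleA fam_scale1 fam_scaleDr fam_scaleDl.

Definition compatible (s : family) :=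
  forall (L L' : LL) (sL'L : {subset val L' <= val L}),
    res sL'L n (s L) = s L'.

Definition compatible_pred : {pred family} := [pred s | `[< compatible s >]].

Lemma compatibleP s : reflect (compatible s) (s \in compatible_pred).
Proof. exact: asboolP. Qed.

Fact compatible_closed : subsemimod_closed compatible_pred.
Proof.
split=> [|a s /compatibleP cs]; last first.
  apply/compatibleP => L L' sL'L.
  by rewrite -[(a *: s) L]/(a *: s L) linearZ /= [res_fun _ _]cs.
split=> [|s t /compatibleP cs /compatibleP ct].
  by apply/compatibleP => L L' sL'L; exact: linear0.
apply/compatibleP => L L' sL'L.
by rewrite -[(s + t) L]/(s L + t L) linearD cs ct.
Qed.

HB.instance Definition _ :=
  GRing.isSubmodClosed.Build k family compatible_pred compatible_closed.

(* The inverse limit of H^n(L, M) over L in LL, as the space of compatible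
   families. *)
Definition local_cohomology := {s : family | s \in compatible_pred}.

HB.instance Definition _ := SubChoice.on local_cohomology.
HB.instance Definition _ := GRing.SubChoice_isSubLmodule.Build k _ _
  local_cohomology compatible_closed.

Definition res_family (c : cohomology (whole G) n) : family :=
  fun L => res (sub_whole (val L)) n c.

Fact res_family_compatible c : res_family c \in compatible_pred.
Proof. by apply/compatibleP => L L' sL'L; exact: res_comp. Qed.

Definition loc_fun (c : cohomology (whole G) n) : local_cohomology :=
  Sub (res_family c) (res_family_compatible c).

Fact loc_fun_linear : linear loc_fun.
Proof.
move=> a c d; apply/val_inj; apply: functional_extensionality_dep => L.
exact: linearP.
Qed.

HB.instance Definition _ := GRing.isLinear.Build k (cohomology (whole G) n)
  local_cohomology *:%R loc_fun loc_fun_linear.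

Definition loc_map : {linear cohomology (whole G) n -> local_cohomology} := loc_fun.

End Limit.
End Cohomology.

Arguments diff {k G M L} n.
Arguments res {k G M L L'} sL'L n.

Section Ext.
Variables (k : fieldType) (G : groupType).

Definition Ext (L : groupClosed G) (i : nat) (X Z : gmodule k G) : lmodType k :=
  cohomology (hom_gmodule X Z) L i.

Definition Ext_local (LL : set (groupClosed G)) (i : nat) (X Z : gmodule k G) :
    lmodType k :=
  local_cohomology (hom_gmodule X Z) LL i.

Definition localization (LL : set (groupClosed G)) (i : nat) (X Z : gmodule k G) :
    {linear Ext (whole G) i X Z -> Ext_local LL i X Z} :=
  loc_map (hom_gmodule X Z) LL i.

End Ext.

(* Main.v *)
From HB Require Import structures.
Require Import Defs.
From mathcomp Require Import all_boot all_algebra.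
From mathcomp Require Import boolp classical_sets functions filter.

(** Zorn's lemma gives, for every proper filter on I, a k-linear functional on
    I -> k that takes the value a on every function eventually equal to a.
    Applied pointwise to bilinear forms on X * Y, along the filter of "large"
    members of LL, it becomes a G-equivariant linear limit on families of
    elements of M = Hom(X, Y^\vee), hence a limit on families of cochains that
    commutes with the differential. Injectivity: if the restriction of a cocycle
    z to each L is d b_L, then z is the coboundary of the limit of the b_L,
    extended by zero to G. Surjectivity: if the z_L represent a compatible
    family, the limit f of their extensions by zero is a cocycle, and f - z_L is
    on L the limit over L' >= L of the coboundaries z_L' - z_L. *)

Set Implicit Arguments.
Unset Strict Implicit.
Unset Printing Implicit Defensive.

Import GRing.Theory.
Local Open Scope ring_scope.
Local Open Scope classical_set_scope.

(** * Linear functionals separating a vector from a subspace *)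

Section SeparatingFunctional.
Variables (k : fieldType) (V : lmodType k).

Definition is_subspace (A : set V) :=
  A 0 /\ forall a u v, A u -> A v -> A (a *: u + v).

Lemma maximal_subspace_avoiding (N : set V) (e : V) : is_subspace N -> ~ N e ->
  exists R : set V, [/\ is_subspace R, N `<=` R, ~ R e
    & forall B, is_subspace B -> R `<=` B -> ~ B e -> B `<=` R].
Proof.
move=> sN Ne.
(* The empty set is admitted so that the union of the empty chain qualifies. *)
pose P (A : set V) := A = set0 \/ [/\ is_subspace A, N `<=` A & ~ A e].
have [F FP Ftot|R [PR Rmax]] := @Zorn_bigcup V P.
  have [->|/set0P[v [A FA Av]]] := eqVneq (\bigcup_(X in F) X) set0; first by left.
  have FP' B w : F B -> B w -> [/\ is_subspace B, N `<=` B & ~ B e].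
    by move=> /FP[->|].
  have [[A0 _] NA _] := FP' _ _ FA Av.
  right; split.
  - split=> [|a u w [B FB Bu] [C FC Cw]]; first by exists A.
    have [BC|CB] := Ftot _ _ FB FC.
      by exists C => //; have [[_ sC] _ _] := FP' _ _ FC Cw; apply: sC => //; apply: BC.
    by exists B => //; have [[_ sB] _ _] := FP' _ _ FB Bu; apply: sB => //; apply: CB.
  - by move=> w Nw; exists A => //; apply: NA.
  - by move=> [B FB Be]; have [_ _] := FP' _ _ FB Be.
(* The empty set is not maximal: [N] is admissible and contains 0. *)
case: PR => [R0|[sR NR Re]].
  case: (Rmax N); last by right; split.
  by rewrite R0; split=> // N0; apply: (N0 0); case: sN.
exists R; split=> // B sB RB Be; apply/not_notP => nBR; apply: (Rmax B); last first.
  by right; split=> //; apply: subset_trans RB.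
by split.
Qed.

(** A maximal [R] is a complement of the line spanned by [e]; [phi] is the coordinate along [e]. *)
Lemma separating_functional (N : set V) (e : V) : is_subspace N -> ~ N e ->
  exists phi : {linear V -> k^o}, phi e = 1 /\ forall v, N v -> phi v = 0.
Proof.
move=> sN Ne; have [R [[R0 sR] NR Re Rmax]] := maximal_subspace_avoiding sN Ne.
have RZ a u : R u -> R (a *: u) by move=> Ru; rewrite -[_ *: _]addr0; apply: sR.
have RB u v : R u -> R v -> R (u - v).
  by move=> Ru Rv; rewrite addrC -scaleN1r; apply: sR.
have decomp v : exists c, R (v - c *: e).
  have [Rv|nRv] := pselect (R v); first by exists 0; rewrite scale0r subr0.
  (* [B] is the subspace [R + k v]. If it avoided [e], maximality would put [v] in [R]; so [e - c v]
     lies in [R], and one solves for [v]. *)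
  pose B : set V := [set u | exists c, R (u - c *: v)].
  have RsubB : R `<=` B by move=> u Ru; exists 0; rewrite scale0r subr0.
  have sB : is_subspace B.
    split=> [|a u w [c Rc] [d Rd]]; first exact: RsubB.
    by exists (a * c + d); rewrite scalerDl opprD addrACA -scalerA -scalerBr; apply: sR.
  have [[c Rc]|nBe] := pselect (B e); last first.
    by case: nRv; apply: (Rmax B) => //; exists 1; rewrite scale1r subrr.
  have c0 : c != 0.
    by apply/eqP => c0; move: Rc; rewrite c0 scale0r subr0.
  exists c^-1; rewrite (_ : _ - _ = - c^-1 *: (e - c *: v)); first exact: RZ.
  by rewrite scalerBr scalerA mulNr mulVf // scaleN1r opprK scaleNr addrC.
have uniq v c d : R (v - c *: e) -> R (v - d *: e) -> c = d.
  move=> Rc Rd; apply/eqP; rewrite -subr_eq0; apply/negP => /negP cd.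
  apply: Re; rewrite -[e](scalerK cd); apply: (RZ).
  rewrite (_ : _ *: e = (v - d *: e) - (v - c *: e)); first exact: RB.
  by rewrite opprB [RHS]addrC addrA subrK scalerBl.
pose f v : k^o := sval (cid (decomp v)).
have fP v : R (v - f v *: e) by rewrite /f; case: cid.
have flin : linear f.
  move=> a u v; apply: (uniq (a *: u + v)); first exact: fP.
  rewrite -[a *: f u]/(a * f u) scalerDl opprD addrACA -scalerA -scalerBr.
  exact: sR.
pose fM := GRing.isLinear.Build _ _ _ _ f flin.
pose phi : {linear V -> k^o} := HB.pack f fM.
exists phi; split=> [|v Nv].
  by apply: (uniq e); [exact: fP|rewrite scale1r subrr].
by apply: (uniq v); [exact: fP|rewrite scale0r subr0; apply: NR].
Qed.

End SeparatingFunctional.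

(** Properness keeps the constant 1 out of the subspace of eventually zero functions, so some [phi]
    kills that subspace and sends 1 to 1. *)
Lemma generalized_limit (k : fieldType) (I : Type) (F : set_system I) :
  ProperFilter F ->
  exists phi : {linear (I -> k^o) -> k^o},
    forall (h : I -> k^o) a, (\forall i \near F, h i = a) -> phi h = a.
Proof.
move=> FF; pose N : set (I -> k^o) := [set h | \forall i \near F, h i = 0].
have sN : is_subspace N.
  split=> [|a u v Nu Nv]; first exact: nearW.
  near=> i; change (a *: u i + v i = 0); rewrite (near Nu i) // (near Nv i) //.
  by rewrite scaler0 addr0.
have [|phi [phi1 phi0]] := @separating_functional k _ N (fun=> 1) sN.
  by move=> /filter_ex[i /eqP]; rewrite oner_eq0.
exists phi => h a Fh; apply/eqP; rewrite -subr_eq0 -[X in _ - X](mulr1 a).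
rewrite -[a * 1]/(a *: (1 : k^o)) -phi1 -linearZ -linearB; apply/eqP/phi0.
near=> i; change (h i - a * 1 = 0); rewrite mulr1 (near Fh i) // subrr //.
Unshelve. all: by end_near. Qed.

Definition generalized_limit_on (k : fieldType) (G : groupType) (M : gmodule k G)
    (I : Type) (F : set_system I) (lim : {linear (I -> M) -> M}) :=
  (forall g h, lim (fun i => act M g (h i)) = act M g (lim h)) /\
  (forall h m, (\forall i \near F, h i = m) -> lim h = m).

(** * Limits of bilinear forms on X * Y *)

Section HomToDual.
Variables (k : fieldType) (G : groupType) (X Y : gmodule k G) (I : Type).
Variable phi : {linear (I -> k^o) -> k^o}.
Let M := hom_gmodule X (dual Y).

Let ev (m : M) (x : X) (y : Y) : k^o :=
  ((m : {linear X -> dual Y}) x : {linear Y -> k^o}) y.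

Definition hom_lim_val (h : I -> M) (x : X) (y : Y) : k^o :=
  phi (fun i => ev (h i) x y).

Fact hom_lim_val_linear h x : linear (hom_lim_val h x).
Proof.
move=> a u v; rewrite /hom_lim_val -linearP; congr (phi _); apply/funext => i.
exact: linearP.
Qed.

HB.instance Definition _ h x :=
  GRing.isLinear.Build k Y k^o *:%R (hom_lim_val h x) (hom_lim_val_linear h x).

Definition hom_lim_dual (h : I -> M) (x : X) : dual Y := hom_lim_val h x.

Fact hom_lim_dual_linear h : linear (hom_lim_dual h).
Proof.
move=> a u v; apply: linear_map_ext => y /=; rewrite /hom_lim_val.
rewrite -linearP; congr (phi _); apply/funext => i.
by rewrite /ev linearP.
Qed.

HB.instance Definition _ h := GRing.isLinear.Build k X (dual Y) *:%R
  (hom_lim_dual h) (hom_lim_dual_linear h).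

Definition hom_lim_fun (h : I -> M) : M := hom_lim_dual h.

Fact hom_lim_linear : linear hom_lim_fun.
Proof.
move=> a h h'; apply: linear_map_ext => x; apply: linear_map_ext => y /=.
by rewrite /hom_lim_val -linearP; congr (phi _); apply/funext.
Qed.

HB.instance Definition _ := GRing.isLinear.Build k (I -> M) M *:%R
  hom_lim_fun hom_lim_linear.

(** An element g acts on a form only by moving its two arguments, so applying [phi] pointwise is
    equivariant. *)
Lemma generalized_limit_on_hom (F : set_system I) :
  (forall (h : I -> k^o) a, (\forall i \near F, h i = a) -> phi h = a) ->
  Filter F ->
  generalized_limit_on F hom_lim_fun.
Proof.
move=> phiF FF; split=> [g h|h m hm].
  by apply: linear_map_ext => x; apply: linear_map_ext.
apply: linear_map_ext => x; apply: linear_map_ext => y.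
by apply: phiF; apply: filterS hm => i <-.
Qed.

End HomToDual.

(** * Limits of cochains *)

Section CochainLimit.
Variables (k : fieldType) (G : groupType) (M : gmodule k G).
Context (I : Type) (F : set_system I) {FF : Filter F}.
Variables (lim : {linear (I -> M) -> M}) (limP : generalized_limit_on F lim).

Definition lim_cochain L n (f : I -> cochain M L n) : cochain M L n :=
  fun g => lim (fun i => f i g).

Lemma diff_lim_cochain L n (f : I -> cochain M L n) :
  diff n (lim_cochain f) = lim_cochain (fun i => diff n (f i)).
Proof.
apply/funext => g; rewrite /= /diff_fun /lim_cochain -limP.1.
(* The differential at [g] is regrouped as a finite linear combination of families [I -> M], to
   which linearity of [lim] applies. *)
transitivity (lim ((fun i => act M (val (g ord0)) (f i (g \o lift ord0)))
    + \sum_(j < n) (-1) ^+ j.+1 *: (f^~ (contract j g))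
    + (-1) ^+ n.+1 *: (f^~ (g \o widen_ord (leqnSn n))))).
  rewrite !linearD linear_sum linearZ; congr (_ + _ + _).
  by apply: eq_bigr => j _; rewrite linearZ.
by congr (lim _); apply/funext => i; rewrite [LHS]/= fct_sumE.
Qed.

(** The limit is taken separately at each [g], so how far along [F] one must go may depend on
    [g]. *)
Lemma lim_cochain_near L n (f : I -> cochain M L n) (z : cochain M L n) :
  (forall g, \forall i \near F, f i g = z g) -> lim_cochain f = z.
Proof. by move=> fz; apply/funext => g; apply: limP.2. Qed.

Lemma lim_coboundary L n (f : I -> cochain M L n) :
  (forall i, is_coboundary (f i)) -> is_coboundary (lim_cochain f).
Proof.
case: n f => [|n] f /= bf.
  by apply: lim_cochain_near => g; apply: nearW => i; rewrite bf.
have [b fb] := choice bf.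
by exists (lim_cochain b); rewrite diff_lim_cochain; congr lim_cochain; apply/funext.
Qed.

End CochainLimit.

(** * Extension of cochains by zero from L to G *)

Section Extension.
Variables (k : fieldType) (G : groupType) (M : gmodule k G) (L : groupClosed G).

(** In general this does not commute with the differential; the arguments below evaluate it on
    tuples from [L], where restriction recovers [f]. *)
Definition ext_cochain n (f : cochain M L n) : cochain M (whole G) n := fun g =>
  if pselect (forall j, val (g j) \in L) is left gL
  then f (fun j => Sub (val (g j)) (gL j)) else 0.

Lemma res_ext_cochain n (f : cochain M L n) :
  res_cochain (sub_whole L) (ext_cochain f) = f.
Proof.
apply/funext => g; rewrite /res_cochain /ext_cochain.
case: pselect => [gL|]; last by case=> j; exact: (valP (g j)).
by congr f; apply/funext => j; apply/val_inj.
Qed.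

Lemma include_whole n (g : 'I_n -> elements (whole G)) :
  (forall j, val (g j) \in L) ->
  exists g' : 'I_n -> elements L, g = include (sub_whole L) \o g'.
Proof.
by move=> gL; exists (fun j => Sub (val (g j)) (gL j)); apply/funext => j; apply/val_inj.
Qed.

End Extension.

Lemma coho_class_eq0 (k : fieldType) (G : groupType) (M : gmodule k G)
    (L : groupClosed G) n (z : cocycle M L n) :
  coho_class z = 0 <-> is_coboundary (val z).
Proof.
have class0 : coho_class (0 : cocycle M L n) = 0.
  by apply: (addrI (coho_class (0 : cocycle M L n))); rewrite -coho_classD !addr0.
by rewrite -class0 coho_class_eq subr0.
Qed.

(** * Injectivity and surjectivity of localization *)

Section LocalSystem.
Variables (k : fieldType) (G : groupType) (M : gmodule k G).
Variables (LL : set (groupClosed G)) (dirLL : local_system LL).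

Definition above : set_system LL :=
  filter_from setT (fun L : LL => [set L' : LL | {subset val L <= val L'}]).

Lemma nonempty_system : exists L : LL, True.
Proof. by have [L LLL _] := dirLL.2 1%g; exists (SigSub (mem_set LLL)). Qed.

#[local] Instance above_proper : ProperFilter above.
Proof.
apply: filter_from_proper; last by move=> L _; exists L.
apply: filter_from_filter; first by have [L _] := nonempty_system; exists L.
move=> L1 L2 _ _.
have [L3 [LL3 s13 s23]] := dirLL.1 _ _ (set_valP L1) (set_valP L2).
exists (SigSub (mem_set LL3)) => // L' s3'.
by split=> x /= Lx; apply: s3'; [exact: s13|exact: s23].
Qed.

Lemma near_above (L : LL) : \forall L' \near above, {subset val L <= val (L' : LL)}.
Proof. by exists L. Qed.

(** Each entry lies in some member of [LL], and a filter is closed under finite intersections. *)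
Lemma near_tuple n (g : 'I_n -> G) :
  \forall L \near above, forall j, g j \in val (L : LL).
Proof.
suff : \forall L \near above, forall j, j \in enum 'I_n -> g j \in val (L : LL).
  by apply: filterS => L gL j; apply: gL; rewrite mem_enum.
elim: (enum 'I_n) => [|j s IH]; first exact: nearW.
have [L LLL gL] := dirLL.2 (g j).
near=> L' => j'; rewrite inE => /predU1P[->|]; last exact: (near IH L').
by apply: (near (near_above (SigSub (mem_set LLL))) L').
Unshelve. all: by end_near. Qed.

Variables (lim : {linear (LL -> M) -> M}) (limP : generalized_limit_on above lim).

Lemma loc_map_inj n : injective (loc_map M LL n).
Proof.
apply: raddf_inj => c; have [z ->] := coho_classP c => locz.
have bz (L : LL) : is_coboundary (res_cochain (sub_whole (val L)) (val z)).
  have : res (sub_whole (val L)) n (coho_class z) = 0.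
    by rewrite -[LHS]/(val (loc_map M LL n (coho_class z)) L) locz.
  by rewrite res_class => /coho_class_eq0.
apply/coho_class_eq0.
pose f (L : LL) := ext_cochain (res_cochain (sub_whole (val L)) (val z)).
(* At any tuple, [f L] agrees with [z] as soon as [L] contains the entries. *)
have -> : val z = lim_cochain lim f.
  apply/esym/(lim_cochain_near limP) => g; apply: filterS (near_tuple (val \o g)).
  move=> L /include_whole[g' ->].
  by rewrite -[LHS]/(res_cochain (sub_whole (val L)) (f L) g') res_ext_cochain.
(* In degree 0 being a coboundary means being 0, so every [f L] vanishes. *)
case: n {c locz} z bz @f => [|n] z bz f /=.
  apply: (lim_cochain_near limP) => g; apply: nearW => L.
  by rewrite /f [res_cochain _ _]bz /ext_cochain; case: pselect.
have /all_sig[b fb] : forall L : LL,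
    {b | res_cochain (sub_whole (val L)) (val z) = diff n b}.
  by move=> L; exact/cid/bz.
exists (lim_cochain lim (fun L => ext_cochain (b L))); rewrite (diff_lim_cochain limP).
apply/funext => g; apply/eqP; rewrite -subr_eq0 -linearB; apply/eqP.
(* Once [L] contains the entries of [g], both sides can be compared after restriction to [L], where
   the extension of [b L] becomes [b L]. *)
apply: limP.2; apply: filterS (near_tuple (val \o g)) => L /include_whole[g' ->].
apply/eqP; rewrite -[_ L]/(_ - _) subr_eq0; apply/eqP.
rewrite -[LHS]/(res_cochain (sub_whole (val L)) (f L) g') res_ext_cochain fb.
rewrite -[RHS]/(res_cochain (sub_whole (val L)) (diff n (ext_cochain (b L))) g').
by rewrite -res_diff res_ext_cochain.
Qed.

Lemma loc_map_surj n (s : local_cohomology M LL n) : exists c, loc_map M LL n c = s.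
Proof.
have /compatibleP sC := valP s.
have /all_sig[z sz] := fun L : LL => cid (coho_classP (val s L)).
pose f := lim_cochain lim (fun L => ext_cochain (val (z L))).
have df : f \in @cocycle_pred _ _ M (whole G) n.
  apply/cocycleP; rewrite (diff_lim_cochain limP).
  apply: (lim_cochain_near limP) => g.
  apply: filterS (near_tuple (val \o g)) => L /include_whole[g' ->].
  rewrite -[LHS]/(res_cochain (sub_whole (val L)) (diff n (ext_cochain _)) g').
  by rewrite -res_diff res_ext_cochain; have /cocycleP -> := valP (z L).
exists (coho_class (Sub f df)); apply/val_inj/functional_extensionality_dep => L.
rewrite -[LHS]/(res (sub_whole (val L)) n (coho_class (Sub f df))) res_class.
rewrite sz; apply/coho_class_eq.
(* The default 0 makes every [d L'] a coboundary, as [lim_coboundary] asks; the limit sees only [L']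
   above [L]. *)
pose d (L' : LL) : cochain M (val L) n :=
  if pselect {subset val L <= val L'} is left sLL'
  then res_cochain sLL' (val (z L')) - val (z L) else 0.
have bd L' : is_coboundary (d L').
  rewrite /d; case: pselect => [sLL'|_]; last first.
    by case: (n) => [//|m] /=; exists 0; rewrite linear0.
  apply: (coho_class_eq (res_cocycle sLL' (z L')) (z L)).1.
  by rewrite -res_class -!sz; apply: sC.
have -> : val (res_cocycle (sub_whole (val L)) (Sub f df) - z L) = lim_cochain lim d.
  apply/funext => g; rewrite -[LHS]/(f (include (sub_whole (val L)) \o g) - val (z L) g).
  (* Writing the fixed value as the limit of a constant family brings the difference under one
     [lim]. *)
  have <- : lim (fun=> val (z L) g) = val (z L) g by apply: limP.2; exact: nearW.
  apply/eqP; rewrite subr_eq -subr_eq0 -linearD -linearB; apply/eqP; apply: limP.2.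
  apply: filterS (near_above L) => L' sLL'.
  apply/eqP; rewrite -[_ L']/(_ - (_ + _)) subr_eq0; apply/eqP.
  rewrite /d; case: pselect => // s'; rewrite -[RHS]/(_ - _ + _) subrK.
  rewrite -[in RHS](res_ext_cochain (val (z L'))); congr (ext_cochain _ _).
  by apply/funext => j; apply/val_inj.
exact: (lim_coboundary limP).
Qed.

End LocalSystem.

Theorem theoremA (k : fieldType) (G : groupType) (LL : set (groupClosed G))
    (X Y : gmodule k G) (i : nat) :
  local_system LL -> bijective (localization LL i X (dual Y)).
Proof.
move=> dirLL; have FF := above_proper dirLL.
have [phi phiF] := @generalized_limit k _ _ FF.
have limP := generalized_limit_on_hom X Y phiF
  (@filter_filter _ _ FF).
rewrite -setTT_bijective; split => //.
  by move=> c d _ _; apply: (loc_map_inj dirLL limP).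
by move=> s _; have [c <-] := loc_map_surj dirLL limP s; exists c.
Qed.
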